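(* For $a=(a_{-3},a_{-2},a_{-1},a_0,a_1,a_2,a_3)^T\in\mathbb{R}^7$ let $d(a)$ be the homogeneous polynomial of degree 4 $$\begin{aligned} d(a)=\;& 25a_{-3}^4+50a_{-3}^2a_{-2}^2+20\sqrt{15}\,a_{-3}a_{-2}^2a_{-1}-10a_{-3}^2a_{-1}^2\\ &+30a_{-2}^2a_{-1}^2+8\sqrt{15}\,a_{-3}a_{-1}^3+21a_{-1}^4-40a_{-3}^2a_0^2+80a_{-2}^2a_0^2\\ &+32a_{-1}^2a_0^2+16a_0^4+120a_{-3}a_{-2}a_0a_1-16\sqrt{15}\,a_{-2}a_{-1}a_0a_1\\ &-10a_{-3}^2a_1^2+30a_{-2}^2a_1^2-24\sqrt{15}\,a_{-3}a_{-1}a_1^2+42a_{-1}^2a_1^2+32a_0^2a_1^2\\ &+21a_1^4+120a_{-3}a_{-1}a_0a_2+8\sqrt{15}\,a_{-1}^2a_0a_2+40\sqrt{15}\,a_{-3}a_{-2}a_1a_2\\ &-8\sqrt{15}\,a_0a_1^2a_2+50a_{-3}^2a_2^2-20\sqrt{15}\,a_{-3}a_{-1}a_2^2+30a_{-1}^2a_2^2\\ &+80a_0^2a_2^2+30a_1^2a_2^2-120a_{-2}a_{-1}a_0a_3-20\sqrt{15}\,a_{-2}^2a_1a_3\\ &+24\sqrt{15}\,a_{-1}^2a_1a_3-8\sqrt{15}\,a_1^3a_3+40\sqrt{15}\,a_{-2}a_{-1}a_2a_3\\ &+120a_0a_1a_2a_3+20\sqrt{15}\,a_1a_2^2a_3+50a_{-3}^2a_3^2+50a_{-2}^2a_3^2\\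 &-10a_{-1}^2a_3^2-40a_0^2a_3^2-10a_1^2a_3^2+50a_2^2a_3^2+25a_3^4 . \end{aligned}$$ Then $d$ is a rotationally invariant measure of the deviation of an octupole from semisymmetry, that is: (i) $d\big(R_x(\alpha)R_y(\beta)R_z(\gamma)\,a\big)=d(a)$ for all $a\in\mathbb{R}^7$ and all $\alpha,\beta,\gamma\in\mathbb{R}$; (ii) $d(a)\ge 0$ for all $a\in\mathbb{R}^7$, and for every $a\in\mathbb{R}^7$ with $a^Ta=1$ one has $d(a)=0$ if and only if $a$ is a semisymmetric octupole.
   Context: Octupoles are the real-valued spherical harmonics of degree 3 on the unit sphere; they form a 7-dimensional real vector space with standard orthonormal basis $Y_{3,-3},Y_{3,-2},\ldots,Y_{3,3}$, and an octupole is identified with its coordinate vector $a=(a_{-3},a_{-2},a_{-1},a_0,a_1,a_2,a_3)^T\in\mathbb{R}^7$ in this basis. The space is closed under 3D rotations. The reference octupole is $Y_{3,-2}$ (proportional to $xyz$), with coordinates $\tilde a=(0,1,0,0,0,0,0)^T$. It possesses half of the octahedral symmetries, the remaining ones holding up to multiplication by $-1$. The semisymmetric octupoles are the rotations of this reference octupole, i.e. all vectors $R_x(\alpha)R_y(\beta)R_z(\gamma)\tilde a$ with Euler angles $\alpha,\beta,\gamma\in\mathbb{R}$. The $7\times 7$ rotation matrices acting on octupole coordinates are $$R_z(\gamma)=\begin{bmatrix}\cos3\gamma&0&0&0&0&0&\sin3\gamma\\0&\cos2\gamma&0&0&0&\sin2\gamma&0\\0&0&\cos\gamma&0&\sin\gamma&0&0\\0&0&0&1&0&0&0\\0&0&-\sin\gamma&0&\cos\gamma&0&0\\0&-\sin2\gamma&0&0&0&\cos2\gamma&0\\-\sin3\gamma&0&0&0&0&0&\cos3\gamma\end{bmatrix},$$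 $$R_x(\tfrac{\pi}{2})=\frac14\begin{bmatrix}0&0&0&\sqrt{10}&0&-\sqrt6&0\\0&-4&0&0&0&0&0\\0&0&0&\sqrt6&0&\sqrt{10}&0\\-\sqrt{10}&0&-\sqrt6&0&0&0&0\\0&0&0&0&-1&0&-\sqrt{15}\\\sqrt6&0&-\sqrt{10}&0&0&0&0\\0&0&0&0&-\sqrt{15}&0&1\end{bmatrix},$$ $$R_y(\beta)=R_x(\tfrac{\pi}{2})\,R_z(\beta)\,R_x(\tfrac{\pi}{2})^T,\qquad R_x(\alpha)=R_y(\tfrac{\pi}{2})^T\,R_z(\alpha)\,R_y(\tfrac{\pi}{2}).$$ *)

(* Defs.v *)
From HB Require Import structures.
From mathcomp Require Import all_boot all_order all_algebra.
From mathcomp Require Import reals trigo.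

Set Implicit Arguments.
Unset Strict Implicit.
Unset Printing Implicit Defensive.

Import Order.TTheory GRing.Theory Num.Theory.

Local Open Scope ring_scope.

(* An octupole is the vector of its coordinates in the orthonormal basis
   Y_{3,-3}, ..., Y_{3,3}: the coordinate a_m has index m + 3 in 'I_7. *)
Notation octupole R := 'cV[R]_7.

Definition coef (R : realType) (a : octupole R) (k : nat) : R := a (inord k) 0.

Definition mx_of_rows (R : realType) (rows : seq (seq R)) : 'M[R]_7 :=
  \matrix_(i < 7, j < 7) nth 0 (nth [::] rows i) j.

Definition Rz (R : realType) (g : R) : 'M[R]_7 :=
  mx_of_rows
   [:: [:: cos (3 * g);    0;              0;         0; 0;       0;             sin (3 * g)];
       [:: 0;              cos (2 * g);    0;         0; 0;       sin (2 * g);   0];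
       [:: 0;              0;              cos g;     0; sin g;   0;             0];
       [:: 0;              0;              0;         1; 0;       0;             0];
       [:: 0;              0;              - sin g;   0; cos g;   0;             0];
       [:: 0;              - sin (2 * g);  0;         0; 0;       cos (2 * g);   0];
       [:: - sin (3 * g);  0;              0;         0; 0;       0;             cos (3 * g)]].

(* The rotation by pi/2 about the x axis. It comes before Rx because Rx is
   itself defined from it, through Ry. *)
Definition Rx_half_pi (R : realType) : 'M[R]_7 :=
  let s6 : R := Num.sqrt 6 in
  let s10 : R := Num.sqrt 10 in
  let s15 : R := Num.sqrt 15 in
  4^-1 *: mx_of_rows
   [:: [:: 0;      0;    0;      s10;  0;      - s6;  0];
       [:: 0;      - 4;  0;      0;    0;      0;     0];
       [:: 0;      0;    0;      s6;   0;      s10;   0];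
       [:: - s10;  0;    - s6;   0;    0;      0;     0];
       [:: 0;      0;    0;      0;    - 1;    0;     - s15];
       [:: s6;     0;    - s10;  0;    0;      0;     0];
       [:: 0;      0;    0;      0;    - s15;  0;     1]].

Definition Ry (R : realType) (b : R) : 'M[R]_7 :=
  Rx_half_pi R *m Rz b *m (Rx_half_pi R)^T.

Definition Rx (R : realType) (al : R) : 'M[R]_7 :=
  (Ry (pi / 2))^T *m Rz al *m Ry (pi / 2).

(* Y_{3,-2}, proportional to xyz. *)
Definition ref_octupole (R : realType) : octupole R := delta_mx (inord 1) 0.

Definition semisymmetric (R : realType) (a : octupole R) : Prop :=
  exists al be ga : R, a = Rx al *m Ry be *m Rz ga *m ref_octupole R.

Definition deviation (R : realType) (a : octupole R) : R :=
  let s15 : R := Num.sqrt 15 in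
  let m3 := coef a 0 in
  let m2 := coef a 1 in
  let m1 := coef a 2 in
  let z := coef a 3 in
  let p1 := coef a 4 in
  let p2 := coef a 5 in
  let p3 := coef a 6 in
  25 * m3 ^+ 4 + 50 * m3 ^+ 2 * m2 ^+ 2 + 20 * s15 * m3 * m2 ^+ 2 * m1
    - 10 * m3 ^+ 2 * m1 ^+ 2
  + 30 * m2 ^+ 2 * m1 ^+ 2 + 8 * s15 * m3 * m1 ^+ 3 + 21 * m1 ^+ 4
    - 40 * m3 ^+ 2 * z ^+ 2 + 80 * m2 ^+ 2 * z ^+ 2
  + 32 * m1 ^+ 2 * z ^+ 2 + 16 * z ^+ 4 + 120 * m3 * m2 * z * p1
    - 16 * s15 * m2 * m1 * z * p1
  - 10 * m3 ^+ 2 * p1 ^+ 2 + 30 * m2 ^+ 2 * p1 ^+ 2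
    - 24 * s15 * m3 * m1 * p1 ^+ 2 + 42 * m1 ^+ 2 * p1 ^+ 2
    + 32 * z ^+ 2 * p1 ^+ 2
  + 21 * p1 ^+ 4 + 120 * m3 * m1 * z * p2 + 8 * s15 * m1 ^+ 2 * z * p2
    + 40 * s15 * m3 * m2 * p1 * p2
  - 8 * s15 * z * p1 ^+ 2 * p2 + 50 * m3 ^+ 2 * p2 ^+ 2
    - 20 * s15 * m3 * m1 * p2 ^+ 2 + 30 * m1 ^+ 2 * p2 ^+ 2
  + 80 * z ^+ 2 * p2 ^+ 2 + 30 * p1 ^+ 2 * p2 ^+ 2 - 120 * m2 * m1 * z * p3
    - 20 * s15 * m2 ^+ 2 * p1 * p3
  + 24 * s15 * m1 ^+ 2 * p1 * p3 - 8 * s15 * p1 ^+ 3 * p3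
    + 40 * s15 * m2 * m1 * p2 * p3
  + 120 * z * p1 * p2 * p3 + 20 * s15 * p1 * p2 ^+ 2 * p3
    + 50 * m3 ^+ 2 * p3 ^+ 2 + 50 * m2 ^+ 2 * p3 ^+ 2
  - 10 * m1 ^+ 2 * p3 ^+ 2 - 40 * z ^+ 2 * p3 ^+ 2 - 10 * p1 ^+ 2 * p3 ^+ 2
    + 50 * p2 ^+ 2 * p3 ^+ 2 + 25 * p3 ^+ 4.

(* Main.v *)
(** The symmetric square of the space of octupoles contains one copy of the
    harmonics of degree 2; let q be the corresponding quadratic map. Then
    d = |q|^2 (suitably scaled), which gives positivity, and invariance because
    Rz and Rx(pi/2) act on the five components of q by orthogonal matrices.
    Suppose d(a) = 0. Restricted to the circle orthogonal to the x axis, the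
    cubic form a is odd, so a rotation about x brings one of its zeros to the y
    axis. After that, a rotation about the y axis can be chosen so that the
    equations q = 0 leave only a combination of Y_{3,-2} and Y_{3,2}, i.e. a
    multiple of a rotation of Y_{3,-2} about the z axis. *)

Require Import Defs.
From HB Require Import structures.
From mathcomp Require Import all_boot all_order all_algebra.
From mathcomp Require Import reals trigo.
From mathcomp Require Import ring lra.
From mathcomp Require Import classical_sets topology normedtype realfun.

Import Order.TTheory GRing.Theory Num.Theory.
Import numFieldNormedType.Exports.

Set Implicit Arguments.
Unset Strict Implicit.
Unset Printing Implicit Defensive.

Local Open Scope ring_scope.

Section Octupoles.

Variable R : realType.
Implicit Types (a b : octupole R) (g t : R).

(** * Coordinates of rotated octupoles *)

Lemma coefP a b : (forall k, (k < 7)%N -> coef a k = coef b k) -> a = b.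
Proof.
move=> eq_ab; apply/colP => i.
by have := eq_ab i (ltn_ord i); rewrite /coef inord_val.
Qed.

Lemma coef_mx_of_rows rows a k : (k < 7)%N ->
  coef (mx_of_rows rows *m a) k =
  \sum_(j < 7) nth 0 (nth [::] rows k) j * coef a j.
Proof.
move=> lt_k; rewrite /coef mxE; apply: eq_bigr => j _.
by rewrite mxE inordK // inord_val.
Qed.

Lemma coef_tr_mx_of_rows rows a k : (k < 7)%N ->
  coef ((mx_of_rows rows)^T *m a) k =
  \sum_(j < 7) nth 0 (nth [::] rows j) k * coef a j.
Proof.
move=> lt_k; rewrite /coef mxE; apply: eq_bigr => j _.
by rewrite !mxE inordK // inord_val.
Qed.

Lemma coef_scale (r : R) a k : coef (r *: a) k = r * coef a k.
Proof. by rewrite /coef mxE. Qed.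

Lemma coef_Rz g a :
  [/\ coef (Rz g *m a) 0 = cos (3 * g) * coef a 0 + sin (3 * g) * coef a 6,
      coef (Rz g *m a) 1 = cos (2 * g) * coef a 1 + sin (2 * g) * coef a 5,
      coef (Rz g *m a) 2 = cos g * coef a 2 + sin g * coef a 4 &
      coef (Rz g *m a) 3 = coef a 3] /\
  [/\ coef (Rz g *m a) 4 = cos g * coef a 4 - sin g * coef a 2,
      coef (Rz g *m a) 5 = cos (2 * g) * coef a 5 - sin (2 * g) * coef a 1 &
      coef (Rz g *m a) 6 = cos (3 * g) * coef a 6 - sin (3 * g) * coef a 0].
Proof.
by do !split; rewrite coef_mx_of_rows // !big_ord_recr big_ord0 /=; ring.
Qed.

Lemma coef_Rx_half_pi a (h := 4^-1 : R) :
  let s6 : R := Num.sqrt 6 in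
  let s10 : R := Num.sqrt 10 in
  let s15 : R := Num.sqrt 15 in
  [/\ coef (Rx_half_pi R *m a) 0 = h * (s10 * coef a 3 - s6 * coef a 5),
      coef (Rx_half_pi R *m a) 1 = - coef a 1,
      coef (Rx_half_pi R *m a) 2 = h * (s6 * coef a 3 + s10 * coef a 5) &
      coef (Rx_half_pi R *m a) 3 = - h * (s10 * coef a 0 + s6 * coef a 2)] /\
  [/\ coef (Rx_half_pi R *m a) 4 = - h * (coef a 4 + s15 * coef a 6),
      coef (Rx_half_pi R *m a) 5 = h * (s6 * coef a 0 - s10 * coef a 2) &
      coef (Rx_half_pi R *m a) 6 = h * (coef a 6 - s15 * coef a 4)].
Proof.
move=> s6 s10 s15.
by do !split; rewrite -scalemxAl coef_scale coef_mx_of_rows //;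
  rewrite !big_ord_recr big_ord0 /= /h -/s6 -/s10 -/s15; field.
Qed.

Lemma trRz g : (Rz g)^T = Rz (- g).
Proof.
apply/matrixP => i j; rewrite !mxE !mulrN !cosN !sinN !opprK.
by case: i => -[|[|[|[|[|[|[|//]]]]]]] ?; case: j => -[|[|[|[|[|[|[|//]]]]]]] ?;
  rewrite /= ?opprK.
Qed.

(** * Multiple angles and orthogonality of the generators *)

Lemma cos_triple g : cos (3 * g) = cos g ^+ 3 - 3 * cos g * sin g ^+ 2.
Proof.
have -> : 3 * g = g + g + g by ring.
by rewrite cosD cosD sinD; ring.
Qed.

Lemma sin_triple g : sin (3 * g) = 3 * cos g ^+ 2 * sin g - sin g ^+ 3.
Proof.
have -> : 3 * g = g + g + g by ring.
by rewrite sinD cosD sinD; ring.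
Qed.

Lemma cos_double g : cos (2 * g) = cos g ^+ 2 - sin g ^+ 2.
Proof.
have -> : 2 * g = g + g by ring.
by rewrite cosD; ring.
Qed.

Lemma sin_double g : sin (2 * g) = 2 * cos g * sin g.
Proof.
have -> : 2 * g = g + g by ring.
by rewrite sinD; ring.
Qed.

Lemma Rz_orth g : (Rz g)^T *m Rz g = 1%:M.
Proof.
rewrite trRz; apply/matrixP => i j.
rewrite !mxE !big_ord_recr big_ord0 /= !mxE !mulrN !cosN !sinN.
have cos2E t : cos t ^+ 2 = 1 - sin t ^+ 2 by rewrite -(cos2Dsin2 t) addrK.
have c1 := cos2E g; have c2 := cos2E (2 * g); have c3 := cos2E (3 * g).
case: i => -[|[|[|[|[|[|[|//]]]]]]] ?; case: j => -[|[|[|[|[|[|[|//]]]]]]] ?;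
  rewrite /= ?mulr1n ?mulr0n; ring: c1 c2 c3.
Qed.

Lemma Rx_half_pi_orth : (Rx_half_pi R)^T *m Rx_half_pi R = 1%:M.
Proof.
have h6 : Num.sqrt 6 ^+ 2 = 6 :> R by rewrite sqr_sqrtr.
have h10 : Num.sqrt 10 ^+ 2 = 10 :> R by rewrite sqr_sqrtr.
have h15 : Num.sqrt 15 ^+ 2 = 15 :> R by rewrite sqr_sqrtr.
apply/matrixP => i j.
rewrite !mxE !big_ord_recr big_ord0 /= !mxE.
by case: i => -[|[|[|[|[|[|[|//]]]]]]] ?; case: j => -[|[|[|[|[|[|[|//]]]]]]] ?;
  rewrite /= ?mulr1n ?mulr0n; field: h6 h10 h15.
Qed.

(** * The deviation as a sum of squares *)

(* With A_m = a_m + i a_{-m}, the weight 1 component [q1 + i q1'] is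
   2 a_0 A_1 + sqrt 15 A_1^* A_2 + 5 A_2^* A_3, and the weight 2 component
   [q2 + i q2'] is 3 A_1^2 - sqrt 15 (2 a_0 A_2 + A_1^* A_3). *)
Definition q0 a : R :=
  4 * coef a 3 ^+ 2 + 3 * (coef a 4 ^+ 2 + coef a 2 ^+ 2)
  - 5 * (coef a 6 ^+ 2 + coef a 0 ^+ 2).

Definition q1 a : R :=
  2 * coef a 3 * coef a 4
  + Num.sqrt 15 * (coef a 4 * coef a 5 + coef a 2 * coef a 1)
  + 5 * (coef a 5 * coef a 6 + coef a 1 * coef a 0).

Definition q1' a : R :=
  2 * coef a 3 * coef a 2
  + Num.sqrt 15 * (coef a 4 * coef a 1 - coef a 2 * coef a 5)
  + 5 * (coef a 5 * coef a 0 - coef a 1 * coef a 6).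

Definition q2 a : R :=
  3 * (coef a 4 ^+ 2 - coef a 2 ^+ 2)
  - Num.sqrt 15 * (2 * coef a 3 * coef a 5
                   + (coef a 4 * coef a 6 + coef a 2 * coef a 0)).

Definition q2' a : R :=
  6 * coef a 4 * coef a 2
  - Num.sqrt 15 * (2 * coef a 3 * coef a 1
                   + (coef a 4 * coef a 0 - coef a 2 * coef a 6)).

(** The weights 1, 2 and 4/3 compensate for the different scalings of the components; with them
    [Rx_half_pi] acts orthogonally on the quintuple. *)
Lemma deviationE a :
  deviation a = q0 a ^+ 2 + 2 * (q1 a ^+ 2 + q1' a ^+ 2)
                + 4 / 3 * (q2 a ^+ 2 + q2' a ^+ 2).
Proof.
have h15 : Num.sqrt 15 ^+ 2 = 15 :> R by rewrite sqr_sqrtr.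
by rewrite /deviation /q0 /q1 /q1' /q2 /q2'; field: h15.
Qed.

Lemma deviation_ge0 a : 0 <= deviation a.
Proof.
have := sqr_ge0 (q0 a); have := sqr_ge0 (q1 a); have := sqr_ge0 (q1' a).
have := sqr_ge0 (q2 a); have := sqr_ge0 (q2' a).
by rewrite deviationE; lra.
Qed.

Lemma deviation_eq0 a : deviation a = 0 ->
  [/\ q0 a = 0, q1 a = 0, q1' a = 0, q2 a = 0 & q2' a = 0].
Proof.
rewrite deviationE => d0.
have := sqr_ge0 (q0 a); have := sqr_ge0 (q1 a); have := sqr_ge0 (q1' a).
have := sqr_ge0 (q2 a); have := sqr_ge0 (q2' a).
by move=> *; split; apply/eqP; rewrite -sqrf_eq0; apply/eqP; lra.
Qed.

(** * Invariance under the generators and their products *)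

Lemma deviation_Rz g a : deviation (Rz g *m a) = deviation a.
Proof.
have c2 : cos g ^+ 2 = 1 - sin g ^+ 2 by rewrite -(cos2Dsin2 g) addrK.
have [[E0 E1 E2 E3] [E4 E5 E6]] := coef_Rz g a.
(* [Rz g] multiplies each A_m by e^{i m g}, so [q0] is fixed, the weight 1 component turns by [g]
   and the weight 2 component by [2 * g]. *)
have e0 : q0 (Rz g *m a) = q0 a.
  by rewrite /q0 !(E0, E1, E2, E3, E4, E5, E6) cos_triple sin_triple; ring: c2.
have e1 : q1 (Rz g *m a) = cos g * q1 a - sin g * q1' a.
  rewrite /q1 /q1' !(E0, E1, E2, E3, E4, E5, E6).
  by rewrite cos_triple sin_triple cos_double sin_double; ring: c2.
have e1' : q1' (Rz g *m a) = cos g * q1' a + sin g * q1 a.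
  rewrite /q1 /q1' !(E0, E1, E2, E3, E4, E5, E6).
  by rewrite cos_triple sin_triple cos_double sin_double; ring: c2.
have e2 : q2 (Rz g *m a) = cos (2 * g) * q2 a - sin (2 * g) * q2' a.
  rewrite /q2 /q2' !(E0, E1, E2, E3, E4, E5, E6).
  by rewrite cos_triple sin_triple cos_double sin_double; ring: c2.
have e2' : q2' (Rz g *m a) = cos (2 * g) * q2' a + sin (2 * g) * q2 a.
  rewrite /q2 /q2' !(E0, E1, E2, E3, E4, E5, E6).
  by rewrite cos_triple sin_triple cos_double sin_double; ring: c2.
rewrite !deviationE e0 e1 e1' e2 e2' cos_double sin_double.
by ring: c2.
Qed.

(** The three radicals are dependent: the product of the first two is twice the third. Written with
    the roots of 2, 3 and 5, such identities follow from the squares alone. *)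
Lemma sqrt_factors :
  [/\ Num.sqrt 6 = Num.sqrt 2 * Num.sqrt 3 :> R,
      Num.sqrt 10 = Num.sqrt 2 * Num.sqrt 5 :> R &
      Num.sqrt 15 = Num.sqrt 3 * Num.sqrt 5 :> R].
Proof. by split; rewrite -sqrtrM //; congr Num.sqrt; ring. Qed.

(** The quarter turn mixes [q0] with [q2], exchanges [q1] and [q2'] up to factors, and negates
    [q1']. *)
Lemma deviation_Rx_half_pi a : deviation (Rx_half_pi R *m a) = deviation a.
Proof.
have [[E0 E1 E2 E3] [E4 E5 E6]] := coef_Rx_half_pi a.
have [s6E s10E s15E] := sqrt_factors.
have h2 : Num.sqrt 2 ^+ 2 = 2 :> R by rewrite sqr_sqrtr.
have h3 : Num.sqrt 3 ^+ 2 = 3 :> R by rewrite sqr_sqrtr.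
have h5 : Num.sqrt 5 ^+ 2 = 5 :> R by rewrite sqr_sqrtr.
have h6 : Num.sqrt 6 ^+ 2 = 6 :> R by rewrite sqr_sqrtr.
have e0 : q0 (Rx_half_pi R *m a) = - (q0 a / 2) - q2 a.
  rewrite /q0 /q2 !(E0, E1, E2, E3, E4, E5, E6) s6E s10E s15E.
  by field: h2 h3 h5.
have e1 : q1 (Rx_half_pi R *m a) = Num.sqrt 6 / 3 * q2' a.
  rewrite /q1 /q2' !(E0, E1, E2, E3, E4, E5, E6) s6E s10E s15E.
  by field: h2 h3 h5.
have e1' : q1' (Rx_half_pi R *m a) = - q1' a.
  rewrite /q1' !(E0, E1, E2, E3, E4, E5, E6) s6E s10E s15E.
  by field: h2 h3 h5.
have e2 : q2 (Rx_half_pi R *m a) = q2 a / 2 - 3 / 4 * q0 a.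
  rewrite /q0 /q2 !(E0, E1, E2, E3, E4, E5, E6) s6E s10E s15E.
  by field: h2 h3 h5.
have e2' : q2' (Rx_half_pi R *m a) = - (Num.sqrt 6 / 2) * q1 a.
  rewrite /q1 /q2' !(E0, E1, E2, E3, E4, E5, E6) s6E s10E s15E.
  by field: h2 h3 h5.
by rewrite !deviationE e0 e1 e1' e2 e2'; field: h6.
Qed.

(** Orthogonality is included to make the class closed under transposition, since [Ry] and [Rx] are
    products involving transposes. *)
Definition dev_isometry (M : 'M[R]_7) : Prop :=
  M^T *m M = 1%:M /\ forall a, deviation (M *m a) = deviation a.

Lemma dev_isometryM M N :
  dev_isometry M -> dev_isometry N -> dev_isometry (M *m N).
Proof.
move=> [MM dM] [NN dN]; split=> [|a]; last by rewrite -mulmxA dM dN.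
by rewrite trmx_mul mulmxA -(mulmxA _ M^T) MM mulmx1.
Qed.

Lemma dev_isometryT M : dev_isometry M -> dev_isometry M^T.
Proof.
move=> [/mulmx1C MM dM]; split=> [|a]; first by rewrite trmxK.
by rewrite -dM mulmxA MM mul1mx.
Qed.

Lemma dev_isometry_Rz g : dev_isometry (Rz g).
Proof. by split; [exact: Rz_orth | exact: deviation_Rz]. Qed.

Lemma dev_isometry_Rx_half_pi : dev_isometry (Rx_half_pi R).
Proof. by split; [exact: Rx_half_pi_orth | exact: deviation_Rx_half_pi]. Qed.

Lemma dev_isometry_Ry g : dev_isometry (Ry g).
Proof.
have iH := dev_isometry_Rx_half_pi.
apply: dev_isometryM; last exact: dev_isometryT.
by apply: dev_isometryM => //; exact: dev_isometry_Rz.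
Qed.

Lemma dev_isometry_Rx g : dev_isometry (Rx g).
Proof.
have iY := dev_isometry_Ry (pi / 2).
apply: dev_isometryM => //; apply: dev_isometryM; last exact: dev_isometry_Rz.
exact: dev_isometryT.
Qed.

(** * Angles obtained from the intermediate value theorem *)

(* Only odd frequencies occur, so the sum changes sign under t |-> t + pi. *)
Lemma trig_zero (x y z w : R) :
  exists t, x * cos (3 * t) + y * sin (3 * t) + z * cos t + w * sin t = 0.
Proof.
pose f t : R := x * cos (3 * t) + y * sin (3 * t) + z * cos t + w * sin t.
have f0 : f 0 = x + z by rewrite /f mulr0 cos0 sin0; ring.
have fpi : f pi = - (x + z).
  by rewrite /f cos_triple sin_triple cospi sinpi; ring.
have cf : continuous f.
  have c3 : continuous (fun t : R => 3 * t).
    by move=> t; apply: cvgM; [exact: cvg_cst | exact: cvg_id].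
  have cM (k : R) h : continuous h -> continuous (fun t : R => k * h t).
    by move=> ch t; apply: cvgM; [exact: cvg_cst | exact: ch].
  move=> t; do 3?[apply: cvgD]; apply: (cM _ _ _ t) => {}t.
  - by apply: continuous_comp; [exact: c3 | exact: continuous_cos].
  - by apply: continuous_comp; [exact: c3 | exact: continuous_sin].
  - exact: continuous_cos.
  - exact: continuous_sin.
have [||t _ ft] := @IVT R f 0 pi 0 (pi_ge0 R); last by exists t.
  exact: continuous_subspaceT.
by rewrite f0 fpi ge_min le_max; lra.
Qed.

(** A zero of x sin t - y cos t makes (x, y) parallel to (cos t, sin t). The factor [k] is then 1 or
    -1, and a shift by [pi] absorbs the sign. *)
Lemma unit_circle_angle (x y : R) :
  x ^+ 2 + y ^+ 2 = 1 -> exists t, cos t = x /\ sin t = y.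
Proof.
move=> xy1; have [t] := trig_zero 0 0 (- y) x.
rewrite !mul0r !add0r => tE; have cs := cos2Dsin2 t.
pose k := x * cos t + y * sin t.
have xE : x = k * cos t.
  rewrite -[LHS]mulr1 -cs -[LHS](subr0 _) -[X in _ - X](mulr0 (sin t)) -tE /k.
  by ring.
have yE : y = k * sin t.
  rewrite -[LHS]mulr1 -cs -[LHS]addr0 -[X in _ + X](mulr0 (cos t)) -tE /k.
  by ring.
have : k ^+ 2 = 1.
  by rewrite -[RHS]xy1 xE yE !exprMn -mulrDr cs mulr1.
move=> /eqP; rewrite sqrf_eq1 => /orP[] /eqP kE.
  by exists t; rewrite xE yE kE !mul1r.
by exists (t + pi); rewrite cosDpi sinDpi xE yE kE !mulN1r.
Qed.

(* The value of the cubic form on the z axis is a multiple of coordinate 3, and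
   [Rx_half_pi^T] moves the y axis there. *)
Lemma rotate_to_y_zero a :
  exists al, coef ((Rx_half_pi R)^T *m ((Rx al)^T *m a)) 3 = 0.
Proof.
pose v := Ry (pi / 2) *m a.
(* Up to the factor 1/4, this sum is coordinate 3 of [(Rx_half_pi R)^T *m (Rz (- t) *m v)]. *)
have [t t0] := trig_zero (Num.sqrt 10 * coef v 0) (- (Num.sqrt 10 * coef v 6))
                 (Num.sqrt 6 * coef v 2) (- (Num.sqrt 6 * coef v 4)).
exists t.
(* The outer quarter turn about y becomes one about z on the other side of [Rx_half_pi^T], where it
   does not affect coordinate 3. *)
have RyH : (Rx_half_pi R)^T *m (Ry (pi / 2))^T =
    Rz (- (pi / 2)) *m (Rx_half_pi R)^T.
  rewrite -trRz -[LHS]trmx_mul -[RHS]trmx_mul /Ry -(mulmxA _ _ (Rx_half_pi R)).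
  by rewrite Rx_half_pi_orth mulmx1.
have -> : (Rx_half_pi R)^T *m ((Rx t)^T *m a) =
    Rz (- (pi / 2)) *m ((Rx_half_pi R)^T *m (Rz (- t) *m v)).
  have assoc (H Y Y' Z Z' : 'M[R]_7) : H *m Y' = Z' *m H ->
      H *m (Y' *m (Z *m Y) *m a) = Z' *m (H *m (Z *m (Y *m a))).
    by move=> HY; rewrite -!mulmxA mulmxA HY -!mulmxA.
  rewrite /Rx [X in X *m a]trmx_mul [X in _ *m X *m a]trmx_mul trmxK trRz.
  exact: assoc RyH.
set w := (Rx_half_pi R)^T *m (Rz (- t) *m v).
have [[_ _ _ ->] _] := coef_Rz (- (pi / 2)) w.
rewrite /w /Rx_half_pi linearZ /= -scalemxAl coef_scale.
rewrite coef_tr_mx_of_rows //.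
rewrite !big_ord_recr big_ord0 /=.
have [[-> _ -> _] _] := coef_Rz (- t) v.
by rewrite mulrN !sinN !cosN; lra.
Qed.

(** * The unit octupoles of zero deviation *)

Lemma coef_ref_octupole k : (k < 7)%N ->
  coef (ref_octupole R) k = (k == 1%N)%:R.
Proof.
move=> lt_k; rewrite /coef mxE eqxx andbT; congr (_%:R).
by congr nat_of_bool; rewrite -val_eqE /= !inordK.
Qed.

Lemma deviation_ref_octupole : deviation (ref_octupole R) = 0.
Proof.
by rewrite deviationE /q0 /q1 /q1' /q2 /q2' !coef_ref_octupole //=; ring.
Qed.

(** If [y] is nonzero, [q2'], [q2] and [q1'] determine coordinates 6, 0 and 5 in turn. If [y = 0],
    coordinate 5 vanishes by hypothesis and [q0] forces coordinates 0 and 6 to vanish. *)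
Lemma coef_deviation_eq0 (c : octupole R) (y := coef c 2) :
  deviation c = 0 -> coef c 3 = 0 -> coef c 4 = 0 ->
  (y = 0 -> coef c 5 = 0) ->
  [/\ coef c 5 = 0, coef c 6 = 0 & 5 * coef c 0 = - Num.sqrt 15 * y].
Proof.
move=> /deviation_eq0[].
rewrite /q0 /q1 /q1' /q2 /q2' -/y => h0 h1 h1' h2 h2' c3 c4 y5.
have h15 : Num.sqrt 15 ^+ 2 = 15 :> R by rewrite sqr_sqrtr.
rewrite c3 c4 in h0 h1 h1' h2 h2'.
have [y0|yN0] := eqVneq y 0.
  rewrite y0 in h0 *; have c5 := y5 y0.
  have := sqr_ge0 (coef c 6); have := sqr_ge0 (coef c 0) => g0 g6.
  by split=> //; [apply/eqP; rewrite -sqrf_eq0; apply/eqP; lra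
                 | rewrite mulr0; have /eqP : coef c 0 ^+ 2 = 0 by [lra];
                   rewrite sqrf_eq0 => /eqP ->; rewrite mulr0].
have sN0 : Num.sqrt 15 != 0 :> R by rewrite sqrtr_eq0 -ltNge.
have c6 : coef c 6 = 0.
  apply: (mulfI (mulf_neq0 sN0 yN0)); rewrite mulr0; lra.
have c0 : 5 * coef c 0 = - Num.sqrt 15 * y.
  apply: (mulfI (mulf_neq0 sN0 yN0)).
  have -> : Num.sqrt 15 * y * (- Num.sqrt 15 * y) = - 15 * y ^+ 2 by ring: h15.
  by lra.
split=> //; apply: (mulfI (mulf_neq0 sN0 yN0)); rewrite mulr0.
have c05 : 5 * coef c 0 * coef c 5 = - Num.sqrt 15 * y * coef c 5 by rewrite c0.
by rewrite c6 in h1'; lra.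
Qed.

Lemma sum_sqr_coef a : a^T *m a = 1%:M -> \sum_(k < 7) coef a k ^+ 2 = 1.
Proof.
move=> /matrixP/(_ 0 0); rewrite !mxE eqxx => norm_a.
by apply: etrans norm_a; apply: eq_bigr => k _;
  rewrite !mxE /coef inord_val expr2.
Qed.

(** In the frame of [b], already turned by [Rx_half_pi^T], rotations about the original y axis are
    given by [Rz]; [be] is the angle of [Ry]. *)
Lemma rotate_to_reference b :
  b^T *m b = 1%:M -> deviation b = 0 -> coef b 3 = 0 ->
  exists be ga, Rx_half_pi R *m ((Rz be)^T *m b) = Rz ga *m ref_octupole R.
Proof.
move=> b1 db b3.
have isoT t := dev_isometryT (dev_isometry_Rz t).
have rot t : [/\ coef ((Rz t)^T *m b) 2 = cos t * coef b 2 - sin t * coef b 4,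
    coef ((Rz t)^T *m b) 3 = coef b 3,
    coef ((Rz t)^T *m b) 4 = cos t * coef b 4 + sin t * coef b 2 &
    coef ((Rz t)^T *m b) 5 = cos (2 * t) * coef b 5 + sin (2 * t) * coef b 1].
  rewrite trRz; have [[_ _ -> ->] [-> -> _]] := coef_Rz (- t) b.
  by rewrite !mulrN !cosN !sinN; split => //; ring.
have [be [be4 be5]] : exists t, coef ((Rz t)^T *m b) 4 = 0 /\
    (coef ((Rz t)^T *m b) 2 = 0 -> coef ((Rz t)^T *m b) 5 = 0).
  have [t t4] := trig_zero 0 0 (coef b 4) (coef b 2).
  have [t2|t2] := eqVneq (coef ((Rz t)^T *m b) 2) 0; last first.
    exists t; split; last by move/eqP; rewrite (negPf t2).
    by have [_ _ -> _] := rot t; lra.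
  (* Here coordinates 2 and 4 of [b] both vanish, hence remain zero under every [Rz]. The angle is
     free to cancel coordinate 5, which has frequency 2, so [u / 2] is used. *)
  have [u u5] := trig_zero 0 0 (coef b 5) (coef b 1).
  have cs := cos2Dsin2 t.
  have t2' : cos t * coef b 2 - sin t * coef b 4 = 0.
    by have [<- _ _ _] := rot t.
  have t4' : coef b 4 * cos t + coef b 2 * sin t = 0 by rewrite -t4; ring.
  have b2 : coef b 2 = 0.
    have -> : coef b 2 = cos t * (cos t * coef b 2 - sin t * coef b 4)
        + sin t * (coef b 4 * cos t + coef b 2 * sin t)
        + coef b 2 * (1 - (cos t ^+ 2 + sin t ^+ 2)) by ring.
    by rewrite t2' t4' cs subrr !mulr0 !addr0.
  have b4 : coef b 4 = 0.
    have -> : coef b 4 = cos t * (coef b 4 * cos t + coef b 2 * sin t)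
        - sin t * (cos t * coef b 2 - sin t * coef b 4)
        + coef b 4 * (1 - (cos t ^+ 2 + sin t ^+ 2)) by ring.
    by rewrite t2' t4' cs subrr !mulr0 subr0 addr0.
  exists (u / 2); have [-> _ -> ->] := rot (u / 2).
  have -> : 2 * (u / 2) = u by field.
  by rewrite b2 b4; split; lra.
pose c := (Rz be)^T *m b; exists be; rewrite -/c.
have c3 : coef c 3 = 0 by have [_ -> _ _] := rot be.
have dc : deviation c = 0 by rewrite (isoT be).2.
have [c5 c6 c0] := coef_deviation_eq0 dc c3 be4 be5.
have [[E0 E1 E2 E3] [E4 E5 E6]] := coef_Rx_half_pi c.
set e := Rx_half_pi R *m c in E0 E1 E2 E3 E4 E5 E6 *.
have [s6E s10E s15E] := sqrt_factors.
have h5 : Num.sqrt 5 ^+ 2 = 5 :> R by rewrite sqr_sqrtr.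
(* The ratio of coordinates 0 and 2 of [c] is exactly the one that cancels here, because sqrt 10
   sqrt 15 = 5 sqrt 6. *)
have {}E3 : coef e 3 = 0.
  rewrite E3; have -> : coef c 0 = - Num.sqrt 15 * coef c 2 / 5.
    by rewrite -c0; field.
  by rewrite s6E s10E s15E; field: h5.
rewrite c3 c5 in E0 E2; rewrite be4 c6 in E4 E6.
have e1 : e^T *m e = 1%:M.
  rewrite trmx_mul mulmxA -(mulmxA _ (Rx_half_pi R)^T) Rx_half_pi_orth mulmx1.
  by rewrite trmx_mul mulmxA -(mulmxA _ (Rz be)^T^T) (isoT be).1 mulmx1.
have := sum_sqr_coef e1.
rewrite !big_ord_recr big_ord0 /= E0 E2 E3 E4 E6 => e1E.
(* Only coordinates 1 and 5 of the unit vector [e] survive. The sign and the later halving match the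
   column (cos 2g, - sin 2g) of [Rz g]. *)
have [t [ct st]] : exists t, cos t = coef e 1 /\ sin t = - coef e 5.
  by apply: unit_circle_angle; rewrite -[RHS]e1E; ring.
exists (t / 2); apply: coefP.
have [[F0 F1 F2 F3] [F4 F5 F6]] := coef_Rz (t / 2) (ref_octupole R).
rewrite !coef_ref_octupole //= in F0 F1 F2 F3 F4 F5 F6.
have t2 : 2 * (t / 2) = t by field.
rewrite t2 in F1 F5.
move=> [|[|[|[|[|[|[|//]]]]]]] _.
- by rewrite E0 F0; ring.
- by rewrite F1 ct; ring.
- by rewrite E2 F2; ring.
- by rewrite E3 F3.
- by rewrite E4 F4; ring.
- by rewrite F5 st; ring.
- by rewrite E6 F6; ring.
Qed.

(** Undoes the reduction: with [H] the quarter turn and [Z] an [Rz], the factor [H *m Z *m H^T] is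
    [Ry] unfolded. *)
Lemma orth_peel n (X H Z : 'M[R]_n) (v : 'cV[R]_n) :
  X^T *m X = 1%:M -> H^T *m H = 1%:M -> Z^T *m Z = 1%:M ->
  X *m (H *m Z *m H^T) *m (H *m (Z^T *m (H^T *m X^T *m v))) = v.
Proof.
move=> XX HH ZZ; rewrite -!mulmxA (mulmxA H^T H) HH mul1mx.
rewrite (mulmxA Z) (mulmx1C ZZ) mul1mx (mulmxA H) (mulmx1C HH) mul1mx.
by rewrite mulmxA (mulmx1C XX) mul1mx.
Qed.

Lemma deviation_eq0_semisymmetric a : a^T *m a = 1%:M ->
  (deviation a = 0 <-> semisymmetric a).
Proof.
move=> a1; split=> [da|[al [be [ga ->]]]]; last first.
  rewrite -2!mulmxA (dev_isometry_Rx al).2 (dev_isometry_Ry be).2.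
  rewrite deviation_Rz; exact: deviation_ref_octupole.
have [al al0] := rotate_to_y_zero a.
(* [HX] undoes the rotation about x and then carries the y axis to the z axis, so that the remaining
   rotation about y acts as an [Rz]. *)
pose HX := (Rx_half_pi R)^T *m (Rx al)^T.
have isoHX : dev_isometry HX.
  apply: dev_isometryM; apply: dev_isometryT; last exact: dev_isometry_Rx.
  exact: dev_isometry_Rx_half_pi.
rewrite mulmxA -/HX in al0.
have HX1 : (HX *m a)^T *m (HX *m a) = 1%:M.
  by rewrite trmx_mul mulmxA -(mulmxA _ HX^T) isoHX.1 mulmx1.
have dHX : deviation (HX *m a) = 0 by rewrite isoHX.2.
have [be [ga E]] := rotate_to_reference HX1 dHX al0.
exists al, be, ga.
rewrite -(mulmxA _ _ (ref_octupole R)) -E /HX /Ry orth_peel //.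
- by have [] := dev_isometry_Rx al.
- exact: Rx_half_pi_orth.
- exact: Rz_orth.
Qed.

End Octupoles.

Theorem lemma2 (R : realType) :
  (forall (a : octupole R) (al be ga : R),
     deviation (Rx al *m Ry be *m Rz ga *m a) = deviation a) /\
  (forall a : octupole R, 0 <= deviation a) /\
  (forall a : octupole R, a^T *m a = 1%:M ->
     (deviation a = 0 <-> semisymmetric a)).
Proof.
split; last first.
  by split; [exact: deviation_ge0 | exact: deviation_eq0_semisymmetric].
move=> a al be ga.
rewrite -2!mulmxA (dev_isometry_Rx al).2 (dev_isometry_Ry be).2.
exact: deviation_Rz.
Qed.
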